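(* Let $(A,\diamond,D,Q)$ be an admissible differential Zinbiel algebra and $q\in\mathbf{k}$. Define binary operations $\lhd_q,\rhd_q:A\otimes A\to A$ by $$a\lhd_q b:=(D+qQ)(b)\diamond a,\qquad a\rhd_q b:=a\diamond(D+qQ)(b),\qquad a,b\in A.$$ Then $(A,\lhd_q,\rhd_q)$ is a pre-Novikov algebra.
   Context: $\mathbf{k}$ is a field of characteristic $0$; all vector spaces are over $\mathbf{k}$ and finite-dimensional. A Zinbiel algebra $(A,\diamond)$ is a vector space with a binary operation satisfying $a\diamond(b\diamond c)=(b\diamond a)\diamond c+(a\diamond b)\diamond c$. An admissible differential Zinbiel algebra $(A,\diamond,D,Q)$ is a Zinbiel algebra with linear maps $D,Q:A\to A$ such that $D(a\diamond b)=a\diamond D(b)+D(a)\diamond b$ and $Q(a\diamond b)=Q(a)\diamond b-a\diamond D(b)=a\diamond Q(b)-D(a)\diamond b$ for all $a,b\in A$. A pre-Novikov algebra $(A,\lhd,\rhd)$ is a vector space with binary operations $\lhd,\rhd$ satisfying, for all $a,b,c\in A$: $a\rhd(b\rhd c)=(a\rhd b+a\lhd b)\rhd c+b\rhd(a\rhd c)-(b\rhd a+b\lhd a)\rhd c$; $a\rhd(b\lhd c)=(a\rhd b)\lhd c+b\lhd(a\lhd c+a\rhd c)-(b\lhd a)\lhd c$; $(a\lhd b+a\rhd b)\rhd c=(a\rhd c)\lhd b$; $(a\lhd b)\lhd c=(a\lhd c)\lhd b$. *)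

(* Defs.v *)
From HB Require Import structures.
From mathcomp Require Import all_boot all_order all_algebra.
Set Implicit Arguments.
Unset Strict Implicit.
Unset Printing Implicit Defensive.
Import GRing.Theory.
Local Open Scope ring_scope.

Record is_zinbiel (k : fieldType) (A : vectType k) (mul : A -> A -> A) : Prop :=
  IsZinbiel {
    zinbiel_bilinear : bilinear_for *:%R *:%R mul;
    zinbiel_axiom : forall a b c : A,
      mul a (mul b c) = mul (mul b a) c + mul (mul a b) c
  }.

Record is_admissible_diff_zinbiel (k : fieldType) (A : vectType k)
    (mul : A -> A -> A) (D Q : 'End(A)) : Prop :=
  IsAdmissibleDiffZinbiel {
    adz_zinbiel : is_zinbiel mul;
    adz_derivation : forall a b : A, D (mul a b) = mul a (D b) + mul (D a) b;
    adz_admissible_l : forall a b : A, Q (mul a b) = mul (Q a) b - mul a (D b);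
    adz_admissible_r : forall a b : A, Q (mul a b) = mul a (Q b) - mul (D a) b
  }.

Record is_pre_novikov (k : fieldType) (A : vectType k)
    (lhd rhd : A -> A -> A) : Prop :=
  IsPreNovikov {
    pn_lhd_bilinear : bilinear_for *:%R *:%R lhd;
    pn_rhd_bilinear : bilinear_for *:%R *:%R rhd;
    pn_axiom1 : forall a b c : A,
      rhd a (rhd b c)
      = rhd (rhd a b + lhd a b) c + rhd b (rhd a c) - rhd (rhd b a + lhd b a) c;
    pn_axiom2 : forall a b c : A,
      rhd a (lhd b c)
      = lhd (rhd a b) c + lhd b (lhd a c + rhd a c) - lhd (lhd b a) c;
    pn_axiom3 : forall a b c : A,
      rhd (lhd a b + rhd a b) c = lhd (rhd a c) b;
    pn_axiom4 : forall a b c : A,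
      lhd (lhd a b) c = lhd (lhd a c) b
  }.

Definition lhd_q (k : fieldType) (A : vectType k) (mul : A -> A -> A)
    (D Q : 'End(A)) (q : k) (a b : A) : A :=
  mul ((D + q *: Q) b) a.

Definition rhd_q (k : fieldType) (A : vectType k) (mul : A -> A -> A)
    (D Q : 'End(A)) (q : k) (a b : A) : A :=
  mul a ((D + q *: Q) b).

(* Main.v *)
(** With [P = D + qQ], the two expressions for [Q (x y)] give
    [P (x y) = (P x) y + (1 - q) x (D y) = x (P y) + (1 - q) (D x) y].
    The Zinbiel axiom says that [a (b c) = (a b + b a) c] is symmetric in [a]
    and [b], and each pre-Novikov axiom follows by expanding [P] of a product in
    one of these two ways. *)
Require Import Defs.
From mathcomp Require Import all_boot all_order all_algebra.
Import GRing.Theory.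
Local Open Scope ring_scope.

Lemma zinbiel_mulCA {k : fieldType} {A : vectType k} {mul : A -> A -> A} :
  is_zinbiel mul -> left_commutative mul.
Proof. by move=> [_ zin] a b c; rewrite !zin addrC. Qed.

Section BilinearMul.

Context {k : fieldType} {A : vectType k} {mul : A -> A -> A}.
Hypothesis mul_bilin : bilinear_for *:%R *:%R mul.

Lemma bilinear_mulDl a b c : mul (a + b) c = mul a c + mul b c.
Proof. by have [/(_ c 1 a b) + _] := mul_bilin; rewrite /= !scale1r. Qed.

Lemma bilinear_mulDr a b c : mul a (b + c) = mul a b + mul a c.
Proof. by have [_ /(_ a 1 b c)] := mul_bilin; rewrite /= !scale1r. Qed.

Lemma bilinear_mulZl t a b : mul (t *: a) b = t *: mul a b.
Proof.
(* Linearity with second vector [0] leaves a term [mul 0 b], which vanishes because additivity at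
   [0 + 0] equates it with its double. *)
have [/(_ b t a 0) + _] := mul_bilin; have := bilinear_mulDl 0 0 b.
by rewrite /= !addr0 => /esym/eqP; rewrite -subr_eq0 addrK => /eqP->; rewrite addr0.
Qed.

Lemma bilinear_mulZr t a b : mul a (t *: b) = t *: mul a b.
Proof.
have [_ /(_ a t b 0)] := mul_bilin; have := bilinear_mulDr a 0 0.
by rewrite /= !addr0 => /esym/eqP; rewrite -subr_eq0 addrK => /eqP->; rewrite addr0.
Qed.

End BilinearMul.

Section AdmissibleDifferential.

Context {k : fieldType} {A : vectType k} {mul : A -> A -> A} {D Q : 'End(A)}.
Hypothesis hA : is_admissible_diff_zinbiel mul D Q.
Variable q : k.

Let P : 'End(A) := D + q *: Q.

Let mul_bilin := zinbiel_bilinear (adz_zinbiel hA).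

(** The Leibniz rule contributes [mul a (D b)] once and [adz_admissible_l] subtracts it [q] times,
    whence the factor [1 - q]. *)
Lemma admissible_mulEl a b : P (mul a b) = mul (P a) b + (1 - q) *: mul a (D b).
Proof.
rewrite /P !add_lfunE !scale_lfunE (adz_derivation hA) (adz_admissible_l hA).
rewrite (bilinear_mulDl mul_bilin) (bilinear_mulZl mul_bilin).
rewrite scalerBl scale1r scalerBr addrA [RHS]addrA; congr (_ - _).
by rewrite -!addrA addrC -addrA.
Qed.

Lemma admissible_mulEr a b : P (mul a b) = mul a (P b) + (1 - q) *: mul (D a) b.
Proof.
rewrite /P !add_lfunE !scale_lfunE (adz_derivation hA) (adz_admissible_r hA).
rewrite (bilinear_mulDr mul_bilin) (bilinear_mulZr mul_bilin).
by rewrite scalerBl scale1r scalerBr addrA [RHS]addrA; congr (_ - _); rewrite addrAC.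
Qed.

End AdmissibleDifferential.

Theorem proposition3p31 (k : fieldType) (hk : [pchar k] =i pred0)
    (A : vectType k) (mul : A -> A -> A) (D Q : 'End(A))
    (hA : is_admissible_diff_zinbiel mul D Q) (q : k) :
  is_pre_novikov (lhd_q mul D Q q) (rhd_q mul D Q q).
Proof.
have hZ := adz_zinbiel hA; have hB := zinbiel_bilinear hZ.
have zin := zinbiel_axiom hZ; have mulCA := zinbiel_mulCA hZ.
have PEl := admissible_mulEl hA q; have PEr := admissible_mulEr hA q.
have mulDl := bilinear_mulDl hB; have mulDr := bilinear_mulDr hB.
have mulZl := bilinear_mulZl hB; have mulZr := bilinear_mulZr hB.
rewrite /lhd_q /rhd_q; move: (D + q *: Q) PEl PEr => P PEl PEr.
split.
- by split=> [b | a] t x y /=; rewrite ?linearP ?mulDr ?mulDl ?mulZr ?mulZl.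
- by split=> [b | a] t x y /=; rewrite ?linearP ?mulDr ?mulDl ?mulZr ?mulZl.
- move=> a b c; rewrite !PEl !mulDr !mulZr !mulDl.
  (* Once swapped, each pair is a right-hand side of [zin]. The subtracted one folds to
     [mul b (mul (P a) (P c))], which cancels against the expansion of [P (mul a (P c))]. *)
  rewrite [mul (mul a _) _ + _]addrC [mul (mul b _) _ + _]addrC -!zin.
  by rewrite (mulCA b a) -addrA [in RHS]addrAC subrr add0r.
(* The choice of [PEr] or [PEl] for each product makes [D] fall only on [P c]. The terms with factor
   [1 - q] then agree by [zin] at [a], [D (P c)], [b], and [zin] at [P c], [P a], [b] cancels the
   subtracted term. *)
- move=> a b c; rewrite PEr raddfD /= PEr PEl !mulDr !mulZr !mulDl !mulZl.
  rewrite (mulCA a (P c)) (zin (P c) (P a) b) (zin a (D (P c)) b) scalerDr.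
  rewrite -addrA; congr (_ + _).
  by rewrite addrACA [X in _ = X + _ - _]addrC addrAC subrr add0r addrC.
(* The last two axioms apply [P] to no product, so the Zinbiel identity alone settles them. *)
- by move=> a b c; rewrite mulDl zin addrC.
- by move=> a b c; rewrite mulCA.
Qed.
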